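(* Let $\mathcal{A}$ be a unital commutative C*-algebra whose set $G(\mathcal{A})$ of invertible elements is dense in $\mathcal{A}$. Let $n\in\mathbb{N}$, $n \geq 1$, let $a_1,\dots,a_n\in\mathcal{A}$, and let $p(z)=(z-a_1)(z-a_2)\cdots(z-a_n)\in\mathcal{A}[z]$, regarded as a function $p:\mathcal{A}\to\mathcal{A}$, with C*-algebraic derivative $p':\mathcal{A}\to\mathcal{A}$. Define $$\mathcal{B} := \{z\in\mathcal{A} : z-a_j \text{ is invertible in } \mathcal{A} \text{ for all } 1\leq j\leq n\},\qquad \mathcal{C} := \{z\in\mathcal{A} : p'(z)=0\}.$$ Then for each $z\in\mathcal{B}\cap\mathcal{C}$ there are positive elements $\omega_{z_1},\dots,\omega_{z_n}\in\mathcal{A}$ such that $$z=\sum_{j=1}^{n}\omega_{z_j}a_j,\qquad \sum_{j=1}^{n}\omega_{z_j}=1.$$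
   Context: $\mathcal{A}[z]$ denotes the set of all polynomials over $\mathcal{A}$, and $G(\mathcal{A})$ denotes the set of all invertible elements of $\mathcal{A}$. ''Positive'' means positive in the C*-algebra sense, and $1$ is the identity of $\mathcal{A}$. C*-algebraic differentiation: let $\mathcal{A}$ be a unital commutative C*-algebra with $G(\mathcal{A})$ dense in $\mathcal{A}$, let $f:\mathcal{A}\to\mathcal{A}$ be a function and $\omega\in\mathcal{A}$. The function $f$ is C*-algebraic differentiable at $\omega$ if there exists $L\in\mathcal{A}$ such that for each $\varepsilon>0$ there exists $\delta>0$ such that whenever $z\in\mathcal{A}$ satisfies $\|z-\omega\|<\delta$ and $z-\omega\in G(\mathcal{A})$, one has $\|(z-\omega)^{-1}(f(z)-f(\omega))-L\|<\varepsilon$. In this case one writes $f'(\omega)=L$. *)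

(* Defs.v *)
From HB Require Import structures.
From mathcomp Require Import all_boot all_order all_algebra.
From mathcomp Require Import complex.
From mathcomp Require Import all_classical all_reals all_analysis.

Set Implicit Arguments.
Unset Strict Implicit.
Unset Printing Implicit Defensive.

Import Order.TTheory GRing.Theory Num.Theory.
Import numFieldNormedType.Exports.

Local Open Scope classical_set_scope.
Local Open Scope ring_scope.

(* The norm takes its values in R[i], as MathComp-Analysis requires of a normed
   module over R[i].  In R[i], 0 <= c and 0 < c entail that c is real, so norms
   and the epsilons below are nonnegative, resp. positive, real numbers.

   The norm is a field of the mixin, and the normedModType structure is derived
   from it afterwards, because Hierarchy Builder rejects a structure inheriting
   both from normedModType and from unitRingType: numDomainType inherits from
   both without going through a common join. *)
HB.mixin Record ComUnitAlgebra_isComCStar (R : realType) A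
    & GRing.ComUnitAlgebra R[i] A := {
  cstar_norm : A -> R[i];
  ler_cstar_normD : forall x y : A,
    cstar_norm (x + y) <= cstar_norm x + cstar_norm y;
  cstar_normZ : forall (c : R[i]) (x : A),
    cstar_norm (c *: x) = `|c| * cstar_norm x;
  cstar_norm0_eq0 : forall x : A, cstar_norm x = 0 -> x = 0;
  ler_cstar_normM : forall x y : A,
    cstar_norm (x * y) <= cstar_norm x * cstar_norm y;
  cstar_norm_complete : forall u : nat -> A,
    (forall e : R[i], 0 < e -> exists N : nat,
       forall m n : nat, (N <= m)%N -> (N <= n)%N ->
         cstar_norm (u m - u n) < e) ->
    exists l : A, forall e : R[i], 0 < e -> exists N : nat,
      forall n : nat, (N <= n)%N -> cstar_norm (u n - l) < e;
  star : A -> A;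
  starD : forall x y : A, star (x + y) = star x + star y;
  starZ : forall (c : R[i]) (x : A), star (c *: x) = Num.conj c *: star x;
  starM : forall x y : A, star (x * y) = star y * star x;
  starK : forall x : A, star (star x) = x;
  cstar_identity : forall x : A,
    cstar_norm (star x * x) = cstar_norm x ^+ 2
}.

#[short(type="comCStarAlgType")]
HB.structure Definition ComCStarAlgebra (R : realType) :=
  {A of GRing.ComUnitAlgebra R[i] A & ComUnitAlgebra_isComCStar R A}.

#[non_forgetful_inheritance]
HB.instance Definition _ (R : realType) (A : comCStarAlgType R) :=
  Lmodule_isNormed.Build R[i] (ComCStarAlgebra.sort A)
    (@ler_cstar_normD R A) (@cstar_normZ R A) (@cstar_norm0_eq0 R A).

Lemma cstar_normE (R : realType) (A : comCStarAlgType R) (x : A) :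
  cstar_norm x = `|x|.
Proof. by []. Qed.

Lemma comCStarAlg_cauchy_cvg (R : realType) (A : comCStarAlgType R)
    (F : set_system A) : ProperFilter F -> cauchy F -> cvg F.
Proof.
move=> FF /cauchy_ballP Fc.
pose r (n : nat) : R[i] := n.+1%:R^-1.
have r0 n : 0 < r n by rewrite invr_gt0 ltr0n.
have rle m n : (m <= n)%N -> r n <= r m.
  by move=> mn; rewrite lef_pV2 ?posrE ?ltr0n// ler_nat ltnS.
have rsmall (e : R[i]) : 0 < e -> exists n, r n < e.
  case: e => ea eb; rewrite ltcE /= => /andP[/eqP -> ea0].
  have [n en] : exists n : nat, ea^-1 < n%:R.
    by exists (Num.bound ea^-1); rewrite archi_boundP// invr_ge0 ltW.
  exists n; have -> : r n = (n.+1%:R^-1 : R)%:C%C.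
    by rewrite fmorphV /= rmorph_nat.
  rewrite ltcR invf_plt ?posrE ?ltr0n//.
  by rewrite (lt_trans en)// ltr_nat.
have /choice[x Fx] (n : nat) : exists x : A, F (ball x (r n)).
  have [[B C] /= [FB FC] BC] := Fc _ (r0 n).
  have [x Bx] := filter_ex FB.
  by exists x; apply: filterS FC => y Cy; apply: (BC (x, y)).
have xx m n : `|x m - x n| < r m + r n.
  have [y [ym yn]] := filter_ex (filterI (Fx m) (Fx n)).
  rewrite -[x m](subrK y) -addrA (le_lt_trans (ler_normD _ _))//.
  by apply: ltrD; [|rewrite distrC]; move: ym yn; rewrite -!ball_normE.
have [e e0|l xl] := @cstar_norm_complete R A x.
  have [N Ne] := rsmall _ (divr_gt0 e0 (ltr0n _ 2)).
  exists N => m n Nm Nn; rewrite (lt_trans (xx m n))// [e]splitr.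
  by apply: ltrD; apply: le_lt_trans Ne; exact: rle.
apply/cvg_ex; exists l; apply/cvg_ballP => e e0.
have [N1 N1e] := rsmall _ (divr_gt0 e0 (ltr0n _ 2)).
have [N2 N2e] := xl _ (divr_gt0 e0 (ltr0n _ 2)).
pose N := maxn N1 N2.
near=> y.
have : ball (x N) (r N) y by near: y; exact: Fx.
rewrite -!ball_normE /= => xNy.
rewrite [e]splitr -(subrK (x N) l) -addrA (le_lt_trans (ler_normD _ _))//.
apply: ltrD; first by rewrite distrC; apply: N2e; exact: leq_maxr.
by rewrite (lt_trans xNy)// (le_lt_trans _ N1e)// rle// leq_maxl.
Unshelve. all: by end_near. Qed.

#[non_forgetful_inheritance]
HB.instance Definition _ (R : realType) (A : comCStarAlgType R) :=
  Uniform_isComplete.Build (ComCStarAlgebra.sort A)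
    (@comCStarAlg_cauchy_cvg R A).

Definition invertibles (R : realType) (A : comCStarAlgType R) : set A :=
  [set u : A | u \is a GRing.unit].
Arguments invertibles {R} A.

Definition spectrum (R : realType) (A : comCStarAlgType R) (x : A) : set R[i] :=
  [set l : R[i] | ~ invertibles A (x - l%:A)].

Definition cstar_positive (R : realType) (A : comCStarAlgType R) (x : A) : Prop :=
  star x = x /\ spectrum x `<=` [set l : R[i] | 0 <= l].

(* f is C*-algebraic differentiable at w, with f'(w) = L; such an L is unique
   as soon as the invertible elements are dense. *)
Definition is_cstar_derive (R : realType) (A : comCStarAlgType R)
    (f : A -> A) (w L : A) : Prop :=
  forall e : R[i], 0 < e -> exists2 d : R[i], 0 < d &
    forall z : A, `|z - w| < d -> invertibles A (z - w) ->
      `|(z - w)^-1 * (f z - f w) - L| < e.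

(* Main.v *)
(* Vanishing of p'(z) means that the inverses u_j = (z - a_j)^-1 sum to 0, as in
   the classical proof of the Gauss-Lucas theorem.  Applying the involution and
   multiplying out, sum_j v_j (z - a_j) = 0 with v_j = u_j^* u_j, so that
   w_j = v_j / S with S = sum_j v_j are the required weights once S is known to
   be invertible and the w_j to be positive.  Both follow from the fact that
   t + sum_k y_k^* y_k is invertible for t > 0, since
   w_j = sum_k (u_j u_k / S)^* (u_j u_k / S).  That fact is proved without
   Gelfand theory: the elements x with |T - x| <= T for some T >= 0 form a cone
   whose closure contains the squares of self-adjoint elements, and t + x is
   invertible by a Neumann series. *)
Require Import Defs.
From HB Require Import structures.
From mathcomp Require Import all_boot all_order all_algebra.
From mathcomp Require Import ring.
From mathcomp Require Import complex.
From mathcomp Require Import all_classical all_reals all_analysis.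
Set Implicit Arguments.
Unset Strict Implicit.
Unset Printing Implicit Defensive.
Import Order.TTheory GRing.Theory Num.Theory.
Import numFieldNormedType.Exports.
Local Open Scope classical_set_scope.
Local Open Scope ring_scope.

(** * The norm and the Neumann series *)

Lemma complex_expr_small (R : realType) (r e : R[i]) :
  0 <= r -> r < 1 -> 0 < e -> exists N : nat, r ^+ N < e.
Proof.
move=> r0 r1 e0.
(* Elements of [R[i]] comparable with 0 are real, so the claim reduces to geometric decay in [R]. *)
have rE := RRe_real (ger0_real r0); have eE := RRe_real (gtr0_real e0).
move: r0 r1 e0; rewrite -rE -eE -[0]/(0%:C)%C -[1]/(1%:C)%C.
rewrite lecR !ltcR => r0 r1 e0.
have /cvg_expr/cvgr0Pnorm_lt/(_ _ e0)[N _ /(_ N (leqnn N))] :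
  `|complex.Re r| < 1 by rewrite ger0_norm.
rewrite /= ger0_norm ?exprn_ge0// => rNe.
by exists N; rewrite -rmorphXn/= ltcR.
Qed.

Lemma norm_lt_eq0 (R : realType) (A : comCStarAlgType R) (x : A) :
  (forall e : R[i], 0 < e -> `|x| < e) -> x = 0.
Proof.
move=> xe; apply/eqP; apply/negPn/negP => x0.
by have := xe `|x|; rewrite normr_gt0 x0 ltxx => /(_ isT).
Qed.

Lemma cstar_normM (R : realType) (A : comCStarAlgType R) (x y : A) :
  `|x * y| <= `|x| * `|y|.
Proof. exact: ler_cstar_normM. Qed.

Lemma cstar_norm1 (R : realType) (A : comCStarAlgType R) : `|1 : A| = 1.
Proof.
have star1 : star (1 : A) = 1.
  by have := starM (star (1 : A)) 1; rewrite mulr1 !starK mulr1.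
have := cstar_identity (1 : A); rewrite star1 mul1r cstar_normE => h.
have n0 : `|1 : A| != 0 by rewrite normr_eq0 oner_neq0.
by apply: (mulfI n0); rewrite mulr1 -expr2 -h.
Qed.

Lemma cstar_normX (R : realType) (A : comCStarAlgType R) (x : A) (n : nat) :
  `|x ^+ n| <= `|x| ^+ n.
Proof.
elim: n => [|n IH]; first by rewrite !expr0 cstar_norm1.
rewrite !exprS (le_trans (cstar_normM _ _))//.
by rewrite ler_wpM2l.
Qed.

Lemma neumann (R : realType) (A : comCStarAlgType R) (x : A) :
  `|x| < 1 -> 1 - x \is a GRing.unit.
Proof.
move=> r1; set r := `|x| in r1 *; have r0 : 0 <= r by exact: normr_ge0.
have d0 : 0 < 1 - r by rewrite subr_gt0.
pose u n : A := \sum_(i < n) x ^+ i.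
have uS n : u n.+1 = u n + x ^+ n by rewrite /u big_ord_recr.
(* The geometric tail bound, with the denominator cleared so that the induction on [k]
   telescopes. *)
have uD n k : (1 - r) * `|u (n + k)%N - u n| <= r ^+ n - r ^+ (n + k).
  elim: k => [|k IH]; first by rewrite addn0 !subrr normr0 mulr0.
  rewrite addnS uS addrAC.
  apply: (@le_trans _ _ ((1 - r) * (`|u (n + k)%N - u n| + r ^+ (n + k)))).
    rewrite ler_pM2l// (le_trans (ler_normD _ _))// lerD2l.
    exact: cstar_normX.
  rewrite mulrDr (le_trans (lerD IH (lexx _)))// exprS.
  by rewrite le_eqVlt; apply/orP; left; apply/eqP; ring.
have uN N n : (N <= n)%N -> `|u n - u N| <= r ^+ N / (1 - r).
  move=> /subnKC <-; rewrite ler_pdivlMr// mulrC (le_trans (uD _ _))//.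
  by rewrite gerBl exprn_ge0.
have tail (e : R[i]) : 0 < e -> exists N, r ^+ N / (1 - r) < e.
  move=> e0; have [N rN] := complex_expr_small r0 r1 (mulr_gt0 e0 d0).
  by exists N; rewrite ltr_pdivrMr.
have [e e0|l ul] := @cstar_norm_complete R A u.
  have [N Ne] := tail _ (divr_gt0 e0 (ltr0n _ 2)).
  exists N => m n Nm Nn; rewrite cstar_normE.
  rewrite -(subrK (u N) (u m)) -addrA (le_lt_trans (ler_normD _ _))//.
  by rewrite [e]splitr ltrD// ?(distrC (u N)) (le_lt_trans _ Ne)// uN.
suff : (1 - x) * l = 1.
  by move=> h; apply/unitrPr; exists l.
apply/eqP; rewrite -subr_eq0; apply/eqP/norm_lt_eq0 => e e0.
have n1x : 0 < `|1 - x|.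
  rewrite normr_gt0 subr_eq0; apply/eqP => x1.
  by move: r1; rewrite /r -x1 cstar_norm1 ltxx.
have e2 : 0 < e / 2 by rewrite divr_gt0.
have [N1 N1e] := ul _ (divr_gt0 e2 n1x).
have [N2 N2e] := complex_expr_small r0 r1 e2.
pose N := maxn N1 N2.
(* Since (1 - x) u_N = 1 - x^N, the defect is split into the distance from the limit and a power of
   x, each below e / 2. *)
have -> : (1 - x) * l - 1 = (1 - x) * (l - u N) - x ^+ N.
  have := subrX1 x N; rewrite -/(u N) => /(canRL (subrK _)) ->; ring.
rewrite (le_lt_trans (ler_normB _ _))// [e]splitr ltrD//.
  rewrite (le_lt_trans (cstar_normM _ _))// mulrC.
  by rewrite -ltr_pdivlMr// distrC N1e// leq_maxl.
rewrite (le_lt_trans (cstar_normX _ _))// (le_lt_trans _ N2e)//.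
by rewrite ler_wiXn2l// ?leq_maxr// ltW.
Qed.

Lemma unit_of_norm_lt (R : realType) (A : comCStarAlgType R) (c : R[i]) (x : A) :
  `|x| < `|c| -> x + c%:A \is a GRing.unit.
Proof.
move=> xc; have c0 : c != 0.
  by rewrite -normr_gt0 (le_lt_trans _ xc).
have -> : x + c%:A = c *: (1 - (- (c^-1 *: x))).
  by rewrite opprK scalerDr scalerA mulfV// scale1r addrC.
rewrite scaler_unit ?unitfE// neumann// normrN normrZ normfV.
by rewrite ltr_pdivrMl ?normr_gt0// mulr1.
Qed.

(** * Algebra of the involution *)

Lemma star1 (R : realType) (A : comCStarAlgType R) : star (1 : A) = 1.
Proof. by have := starM (star (1 : A)) 1; rewrite mulr1 !starK mulr1. Qed.

Lemma star_alg (R : realType) (A : comCStarAlgType R) (c : R[i]) :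
  star (c%:A : A) = (Num.conj c)%:A.
Proof. by rewrite starZ star1. Qed.

Lemma starN (R : realType) (A : comCStarAlgType R) (x : A) :
  star (- x) = - star x.
Proof. by rewrite -scaleN1r starZ rmorphN rmorph1 scaleN1r. Qed.

Lemma star0 (R : realType) (A : comCStarAlgType R) : star (0 : A) = 0.
Proof. by rewrite -[X in star X](subrr (0 : A)) starD starN subrr. Qed.

Lemma star_sum (R : realType) (A : comCStarAlgType R) (n : nat) (x : 'I_n -> A) :
  star (\sum_(j < n) x j) = \sum_(j < n) star (x j).
Proof.
elim: n x => [|n IH] x; last by rewrite !big_ord_recr/= starD IH.
by rewrite !big_ord0 star0.
Qed.

Lemma starV (R : realType) (A : comCStarAlgType R) (x : A) :
  x \is a GRing.unit ->
  star x \is a GRing.unit /\ star x^-1 = (star x)^-1.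
Proof.
move=> xu; have h : star x * star x^-1 = 1.
  by rewrite -starM mulVr// star1.
have su : star x \is a GRing.unit by apply/unitrPr; exists (star x^-1).
by split=> //; apply: (mulrI su); rewrite h divrr.
Qed.

(** * Self-adjoint elements: real spectrum and the Cayley transform *)

Lemma algM (R : realType) (A : comCStarAlgType R) (c d : R[i]) :
  (c * d)%:A = c%:A * d%:A :> A.
Proof. by rewrite -scalerAl mul1r scalerA. Qed.

Lemma alg_i2 (R : realType) (A : comCStarAlgType R) :
  ('i%:A : A) * 'i%:A = -1.
Proof. by rewrite -algM -expr2 sqrCi scaleN1r. Qed.

(* For t >= 0, |h - it|^2 = |h^2 + t^2| <= |h|^2 + t^2, which is less than
   (t + 1)^2 for t large, so that h - it is dominated by i(t + 1). *)
Lemma selfadj_addi_unit (R : realType) (A : comCStarAlgType R) (h : A) :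
  star h = h -> h + 'i%:A \is a GRing.unit.
Proof.
(* With t = |h|^2 the bound |h|^2 + t^2 becomes t + t^2, which is below (t + 1)^2. *)
move=> hh; have [t tE] : exists t, t = `|h| ^+ 2 by exists (`|h| ^+ 2).
have t0 : 0 <= t by rewrite tE exprn_ge0.
have -> : h + 'i%:A = h - ('i * t)%:A + ('i * (t + 1))%:A.
  by rewrite mulrDr mulr1 scalerDl; ring.
apply: unit_of_norm_lt.
rewrite normrM normCi mul1r (ger0_norm (addr_ge0 t0 ler01)).
rewrite -(@ltr_pXn2r _ 2)// ?nnegrE ?addr_ge0// -cstar_normE -cstar_identity.
rewrite cstar_normE -scaleNr starD hh star_alg.
have -> : (h + (Num.conj (- ('i * t)))%:A) * (h + (- ('i * t))%:A) =
          h * h + (t ^+ 2)%:A.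
  have tr : Num.conj t = t by apply/CrealP/ger0_real.
  rewrite rmorphN rmorphM/= conjCi tr mulNr opprK scaleNr.
  rewrite expr2 !algM.
  have := alg_i2 A; set I := 'i%:A; set T := t%:A => II.
  have -> : (h + I * T) * (h - I * T) = h * h - (I * I) * (T * T) by ring.
  by rewrite II; ring.
rewrite (le_lt_trans (ler_normD _ _))//.
rewrite normrZ cstar_norm1 mulr1 ger0_norm ?exprn_ge0//.
rewrite (le_lt_trans (lerD (cstar_normM _ _) (lexx _)))//.
rewrite -expr2 -tE sqrrD1 addrC -addrA ltrD2l mulr2n -addrA ltrDl.
by rewrite ltr_wpDl.
Qed.

Lemma selfadj_add_imag_unit (R : realType) (A : comCStarAlgType R) (h : A)
    (b : R[i]) :
  star h = h -> b \is Num.real -> b != 0 ->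
  h + ('i * b)%:A \is a GRing.unit.
Proof.
move=> hh br b0.
have -> : h + ('i * b)%:A = b *: (b^-1 *: h + 'i%:A).
  by rewrite scalerDr !scalerA mulfV// scale1r mulrC.
rewrite scaler_unit ?unitfE// selfadj_addi_unit// starZ hh.
by have /CrealP -> : b^-1 \is Num.real by rewrite realV.
Qed.

(* 1 - 2 / (1 + g^2) is the real part of the Cayley transform
   (g - i) / (g + i), which is unitary. *)
Lemma cayley_norm (R : realType) (A : comCStarAlgType R) (g : A) :
  star g = g -> 1 + g * g \is a GRing.unit /\
  `|1 - 2 * (1 + g * g)^-1| <= 1.
Proof.
move=> gg; have II := alg_i2 A; set I : A := 'i%:A in II *.
have sI : star I = - I by rewrite star_alg conjCi scaleNr.
pose P := g + I; pose M := g - I.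
have Pu : P \is a GRing.unit by exact: selfadj_addi_unit.
have sP : star P = M by rewrite starD gg sI.
have sM : star M = P by rewrite -sP starK.
have Mu : M \is a GRing.unit by rewrite -sP; have [] := starV Pu.
have PM : 1 + g * g = P * M.
  have -> : P * M = g * g - I * I by rewrite /P/M; ring.
  by rewrite II; ring.
split; first by rewrite PM unitrM Pu.
pose U := M * P^-1.
have sU : star U = M^-1 * P.
  by rewrite starM; have [_ ->] := starV Pu; rewrite sM sP.
have UU : star U * U = 1.
  by rewrite sU /U mulrA -(mulrA M^-1) (mulrC P) mulrA mulVr// mul1r divrr.
(* Unitary elements have norm 1, by the C*-identity. *)
have n1 (x : A) : star x * x = 1 -> `|x| = 1.
  move=> x1; have := cstar_identity x; rewrite x1 !cstar_normE cstar_norm1.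
  by move/esym/eqP; rewrite sqrp_eq1// => /eqP.
have nU := n1 _ UU.
have nsU : `|star U| = 1 by apply: n1; rewrite starK mulrC.
have -> : 1 - 2 * (1 + g * g)^-1 = 2^-1 *: (U + star U).
  apply: (@scalerI _ _ (2 : R[i])); first by rewrite pnatr_eq0.
  rewrite scalerA mulfV ?pnatr_eq0// scale1r PM invrM// sU /U.
  rewrite scaler_nat.
  have -> : M * P^-1 = 1 - 2 * I * P^-1.
    have -> : M * P^-1 = P * P^-1 - 2 * I * P^-1 by rewrite /M /P; ring.
    by rewrite divrr.
  have -> : M^-1 * P = 1 + 2 * I * M^-1.
    have -> : M^-1 * P = M^-1 * M + 2 * I * M^-1 by rewrite /M /P; ring.
    by rewrite mulVr.
  (* The resolvent identity for g - i and g + i. *)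
  have E : M^-1 - P^-1 = 2 * I * (M^-1 * P^-1).
    have -> : 2 * I = P - M by rewrite /P /M; ring.
    rewrite mulrBl mulrCA divrr// mulr1.
    by rewrite mulrA divrr// mul1r.
  have -> : 1 - 2 * I * P^-1 + (1 + 2 * I * M^-1) = 2 + 2 * I * (M^-1 - P^-1).
    by ring.
  rewrite E.
  have -> : 2 * I * (2 * I * (M^-1 * P^-1)) = 4 * (I * I) * (M^-1 * P^-1).
    by ring.
  by rewrite II; ring.
rewrite normrZ normfV ger0_norm ?ler0n// ler_pdivrMl ?ltr0n// mulr1.
by rewrite (le_trans (ler_normD _ _))// nU nsU.
Qed.

(** * The cone of positive elements *)

(* Membership in the closed cone of positive elements, in terms of the norm
   alone: x is positive when |T - x| <= T for some real T >= 0.  The slack e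
   spares taking limits. *)
Definition norm_pos (R : realType) (A : comCStarAlgType R) (x : A) : Prop :=
  forall e : R[i], 0 < e -> exists2 T : R[i], 0 <= T & `|T%:A - x| <= T + e.

Lemma norm_pos0 (R : realType) (A : comCStarAlgType R) : norm_pos (0 : A).
Proof.
by move=> e e0; exists 0; rewrite // scale0r subrr normr0 add0r ltW.
Qed.

Lemma norm_posD (R : realType) (A : comCStarAlgType R) (x y : A) :
  norm_pos x -> norm_pos y -> norm_pos (x + y).
Proof.
move=> hx hy e e0; have e2 : 0 < e / 2 by rewrite divr_gt0.
have [T1 T10 T1x] := hx _ e2; have [T2 T20 T2y] := hy _ e2.
exists (T1 + T2); first exact: addr_ge0.
rewrite scalerDl opprD addrACA (le_trans (ler_normD _ _))//.
by rewrite (le_trans (lerD T1x T2y))// addrACA -splitr.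
Qed.

Lemma norm_pos_sum (R : realType) (A : comCStarAlgType R) (n : nat)
    (P : pred 'I_n) (x : 'I_n -> A) :
  (forall j, norm_pos (x j)) -> norm_pos (\sum_(j < n | P j) x j).
Proof.
move=> hx; apply: big_ind => //; first exact: norm_pos0.
exact: norm_posD.
Qed.

(** With slack t / 2, the element x - T has norm at most T + t / 2 < T + t, so adding the scalar T +
    t to it gives a unit. *)
Lemma norm_pos_add_unit (R : realType) (A : comCStarAlgType R) (x : A)
    (t : R[i]) : norm_pos x -> 0 < t -> x + t%:A \is a GRing.unit.
Proof.
move=> hx t0; have [T T0 Tx] := hx _ (divr_gt0 t0 (ltr0n _ 2)).
have -> : x + t%:A = (x - T%:A) + (T + t)%:A by rewrite scalerDl; ring.
apply: unit_of_norm_lt; rewrite distrC (le_lt_trans Tx)//.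
rewrite ger0_norm ?addr_ge0 ?(ltW t0)// ltrD2l.
by rewrite ltr_pdivrMr// mulr_natr mulr2n ltrDl.
Qed.

(* With g = h / s and b = (1 + g^2)^-1, the element h^2 b = s^2 (1 - b) lies in
   the cone by the Cayley bound, and differs from h^2 by h^4 b / s^2, which is
   small for s large. *)
Lemma norm_pos_sqr (R : realType) (A : comCStarAlgType R) (h : A) :
  star h = h -> norm_pos (h * h).
Proof.
(* This scale satisfies |h|^4 / e <= s <= s^2, so the final error |h|^4 / s^2 is at most e; the
   summand 1 gives s >= 1. *)
move=> hh e e0; pose s := `|h| ^+ 4 / e + 1.
have K0 : 0 <= `|h| ^+ 4 / e by rewrite divr_ge0 ?exprn_ge0// ltW.
have s1 : 1 <= s by rewrite lerDr.
have s0 : 0 < s by rewrite (lt_le_trans ltr01).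
pose g := s^-1 *: h.
have gg : star g = g.
  rewrite starZ hh; have /CrealP -> // : s^-1 \is Num.real.
  by rewrite realV gtr0_real.
have hE : h * h = s ^+ 2 *: (g * g).
  have hg : h = s *: g by rewrite /g scalerA mulfV ?scale1r// gt_eqF.
  by rewrite {1 2}hg -(scalerAl s g) -(scalerAr s g) scalerA expr2.
have [] := cayley_norm gg; set b := (_)^-1 => bu nb.
have n2b : `|2 * b| <= 2.
  have -> : 2 * b = 1 - (1 - 2 * b) by ring.
  rewrite (le_trans (ler_normB _ _))// cstar_norm1.
  by rewrite -[leRHS]/(1 + 1) lerD2l.
have bE : g * g * b = 1 - b.
  have := divrr bu; rewrite -/b mulrDl mul1r => bb.
  by rewrite -bb; ring.
exists (s ^+ 2 / 2); first by rewrite divr_ge0 ?exprn_ge0// ltW.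
(* With T = s^2 / 2, T - h^2 = T (1 - 2 g^2). The term 1 - 2 b has norm at most 1 by the Cayley
   bound, and the remainder 2 g^4 b has norm at most 2 |g|^4. *)
have -> : (s ^+ 2 / 2)%:A - h * h =
    (s ^+ 2 / 2) *: (- (1 - 2 * b) - g ^+ 4 * (2 * b)).
  have -> : - (1 - 2 * b) - g ^+ 4 * (2 * b) = 1 - (g * g) *+ 2.
    have -> : g ^+ 4 * (2 * b) = 2 * (g * g) * (g * g * b) by ring.
    have -> : 2 * (g * g) * (g * g * b) = 2 * (g * g) - 2 * (g * g * b).
      by rewrite {1}bE; ring.
    by rewrite bE; ring.
  rewrite hE scalerBr -(scaler_nat 2 (g * g)) (scalerA (s ^+ 2 / 2)).
  by rewrite divfK ?pnatr_eq0.
have g4 : `|g| ^+ 4 = `|h| ^+ 4 / s ^+ 4.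
  by rewrite normrZ normfV (gtr0_norm s0) exprMn exprVn mulrC.
have p0 : 0 <= s ^+ 2 / 2 by rewrite divr_ge0 ?exprn_ge0// ltW.
rewrite normrZ (ger0_norm p0).
apply: (@le_trans _ _ (s ^+ 2 / 2 * (1 + `|g| ^+ 4 * 2))).
  rewrite ler_wpM2l// (le_trans (ler_normB _ _))// normrN lerD//.
  rewrite (le_trans (cstar_normM _ _))// ler_pM//.
  exact: cstar_normX.
rewrite mulrDr mulr1 lerD2l g4.
have -> : s ^+ 2 / 2 * (`|h| ^+ 4 / s ^+ 4 * 2) = `|h| ^+ 4 / s ^+ 2.
  by field; rewrite gt_eqF.
rewrite ler_pdivrMr ?exprn_gt0// mulrC -ler_pdivrMr//.
rewrite (@le_trans _ _ s)// ?lerDl// expr2 ler_pMl//.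
Qed.

(** Write y = (h - i k) / 2 with h and k self-adjoint; by commutativity the cross terms cancel and
    [star y * y] is (h / 2)^2 + (k / 2)^2. *)
Lemma norm_pos_starsq (R : realType) (A : comCStarAlgType R) (y : A) :
  norm_pos (star y * y).
Proof.
pose h := y + star y; pose k := 'i *: (y - star y).
have hh : star h = h by rewrite starD starK addrC.
have kk : star k = k.
  by rewrite /k starZ conjCi starD starN starK scaleNr -scalerN opprB.
have half (x : A) : star x = x -> star (2^-1 *: x) = 2^-1 *: x.
  move=> xx; rewrite starZ xx; have /CrealP -> // : (2^-1 : R[i]) \is Num.real.
  by rewrite realV realn.
have sqZ (c : R[i]) (x : A) : (c *: x) * (c *: x) = c ^+ 2 *: (x * x).
  by rewrite -(scalerAl c) -(scalerAr c) scalerA expr2.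
have -> : star y * y =
    (2^-1 *: h) * (2^-1 *: h) + (2^-1 *: k) * (2^-1 *: k).
  rewrite !sqZ sqrCi scaleN1r -scalerDr /h.
  have -> : (y + star y) * (y + star y) - (y - star y) * (y - star y) =
            (star y * y) *+ 4 by ring.
  by rewrite -(scaler_nat 4) scalerA exprVn -natrX mulVf ?scale1r//.
by apply: norm_posD; apply: norm_pos_sqr; exact: half.
Qed.

(** A non-real l is excluded from the spectrum by self-adjointness, a negative real l because x +
    (-l) is then a unit by membership in the cone. *)
Lemma norm_pos_cstar_positive (R : realType) (A : comCStarAlgType R) (x : A) :
  star x = x -> norm_pos x -> cstar_positive x.
Proof.
move=> xx px; split=> // l; rewrite /spectrum/invertibles/= => nu.
apply: contrapT => nl; apply: nu.
have [iml|iml] := eqVneq ('Im l) 0.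
  have lr : l \is Num.real by apply/Creal_ImP.
  rewrite -scaleNr; apply: norm_pos_add_unit => //.
  by rewrite oppr_gt0 real_ltNge ?real0//; apply/negP.
have -> : x - l%:A = x - ('Re l)%:A + ('i * - 'Im l)%:A.
  by rewrite {1}[l]Crect scalerDl mulrN scaleNr opprD addrA.
apply: selfadj_add_imag_unit; rewrite ?oppr_eq0 ?rpredN ?Creal_Im//.
rewrite -scaleNr starD star_alg xx; congr (x + _%:A).
by apply/CrealP; rewrite rpredN Creal_Re.
Qed.

(** Factoring out the invertible k-th term leaves 1 plus a sum of elements [star (y j) * y j] of the
    cone. *)
Lemma starsq_sum_unit (R : realType) (A : comCStarAlgType R) (n : nat)
    (u : 'I_n -> A) (k : 'I_n) :
  u k \is a GRing.unit -> \sum_(j < n) star (u j) * u j \is a GRing.unit.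
Proof.
move=> uk; have [suk sV] := starV uk.
pose y j := u j / u k.
have -> : \sum_(j < n) star (u j) * u j =
    (star (u k) * u k) * (\sum_(j < n | j != k) star (y j) * y j + 1%:A).
  rewrite (bigD1 k)//= addrC scale1r mulrDr mulr1 mulr_sumr; congr (_ + _).
  apply: eq_bigr => j _; rewrite /y starM sV.
  have -> : (star (u k) * u k) * ((star (u k))^-1 * star (u j) * (u j / u k)) =
     (star (u k) / star (u k)) * (u k / u k) * (star (u j) * u j) by ring.
  by rewrite !divrr// !mul1r.
rewrite unitrM unitrM suk uk/= norm_pos_add_unit//.
by apply: norm_pos_sum => j; exact: norm_pos_starsq.
Qed.

(** * Polynomial functions and their C*-algebraic derivative *)

Lemma horner_bounded (R : realType) (A : comCStarAlgType R) (q : {poly A})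
    (M : R[i]) :
  exists2 K : R[i], 0 <= K & forall x : A, `|x| <= M -> `|q.[x]| <= K.
Proof.
elim/poly_ind: q => [|q c [K K0 qK]].
  by exists 0 => // x _; rewrite horner0 normr0.
(* [M] is an arbitrary complex number, so its absolute value keeps the bound nonnegative even when
   no x satisfies |x| <= M. *)
exists (K * `|M| + `|c|); first by rewrite addr_ge0// mulr_ge0.
move=> x xM; rewrite hornerMXaddC (le_trans (ler_normD _ _))// lerD2r.
rewrite (le_trans (cstar_normM _ _))// ler_pM// ?qK//.
by rewrite (le_trans xM)// real_ler_norm// ger0_real// (le_trans _ xM).
Qed.

Lemma poly_sub_horner (R : comNzRingType) (p : {poly R}) (z : R) :
  exists q : {poly R}, p - p.[z]%:P = q * ('X - z%:P).
Proof.
by apply/factor_theorem/rootP; rewrite hornerD hornerN hornerC subrr.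
Qed.

Lemma horner_near (R : realType) (A : comCStarAlgType R) (q : {poly A})
    (z : A) (e : R[i]) : 0 < e ->
  exists2 d : R[i], 0 < d & forall x : A, `|x - z| < d -> `|q.[x] - q.[z]| < e.
Proof.
move=> e0; have [q1 qE] := poly_sub_horner q z.
have [K K0 qK] := horner_bounded q1 (`|z| + 1).
have K1 : 0 <= (K + 1) / e by rewrite divr_ge0 ?addr_ge0// ltW.
have d0 : 0 < 1 + (K + 1) / e by rewrite ltr_pwDl.
(* This radius d is at most 1, which keeps x where the bound K on the quotient [q1] holds, and it
   satisfies K d < e. *)
exists (1 + (K + 1) / e)^-1; first by rewrite invr_gt0.
move=> x xd.
have x1 : `|x| <= `|z| + 1.
  rewrite -(subrK z x) addrC (le_trans (ler_normD _ _))// lerD2l.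
  by rewrite (le_trans (ltW xd))// invf_le1// lerDl.
have -> : q.[x] - q.[z] = q1.[x] * (x - z).
  have := congr1 (fun r : {poly A} => r.[x]) qE.
  by rewrite /= hornerD hornerN hornerC hornerM hornerXsubC.
rewrite (le_lt_trans (cstar_normM _ _))//.
apply: (@le_lt_trans _ _ (K * (1 + (K + 1) / e)^-1)).
  by rewrite ler_pM ?qK ?(ltW xd)//.
rewrite ltr_pdivrMr// mulrDr mulr1 mulrCA divff ?gt_eqF// mulr1.
by rewrite addrCA ltrDl ltr_wpDl ?(ltW e0).
Qed.

(** Write p - p(z) = q (X - z). The difference quotient along an invertible increment w is q(z + w);
    as such w are arbitrarily small by density, continuity of q forces L = q(z), which is the formal
    derivative at z. *)
Lemma is_cstar_derive_horner (R : realType) (A : comCStarAlgType R)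
    (p : {poly A}) (z L : A) :
  dense (invertibles A) -> is_cstar_derive (fun x => p.[x]) z L ->
  p^`().[z] = L.
Proof.
move=> dA pL; have [q pE] := poly_sub_horner p z.
have -> : p^`().[z] = q.[z].
  have := congr1 (fun r : {poly A} => r^`().[z]) pE.
  rewrite /= derivB derivC subr0 derivM derivXsubC mulr1 => ->.
  by rewrite hornerD hornerM hornerXsubC subrr mulr0 add0r.
apply/eqP; rewrite -subr_eq0; apply/eqP/norm_lt_eq0 => e e0.
have e2 : 0 < e / 2 by rewrite divr_gt0.
have [d1 d10 pd1] := pL _ e2; have [d2 d20 qd2] := horner_near q z e2.
have [w [[w1 w2] wu]] : (ball (0 : A) d1 `&` ball 0 d2) `&` invertibles A !=set0.
  apply: dA; first by exists 0; split; exact: ballxx.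
  by apply: openI; exact: ball_open.
move: w1 w2; rewrite -!ball_normE /= !sub0r !normrN => w1 w2.
have zw : z + w - z = w by rewrite addrC addKr.
have := pd1 (z + w); have := qd2 (z + w); rewrite zw => /(_ w2) hq /(_ w1 wu).
have -> : p.[z + w] - p.[z] = q.[z + w] * w.
  have := congr1 (fun r : {poly A} => r.[z + w]) pE.
  by rewrite /= hornerD hornerN hornerC hornerM hornerXsubC zw.
rewrite mulrC mulrK// => hL.
rewrite -(subrK q.[z + w] q.[z]) -addrA (le_lt_trans (ler_normD _ _))//.
by rewrite [e]splitr ltrD// distrC.
Qed.

(** The logarithmic derivative of a product of linear factors. *)
Lemma deriv_prodXsubC (R : comUnitRingType) (n : nat) (a : 'I_n -> R) (z : R) :
  (forall j, z - a j \is a GRing.unit) ->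
  (\prod_(j < n) ('X - (a j)%:P))^`().[z] =
  (\prod_(j < n) (z - a j)) * \sum_(j < n) (z - a j)^-1.
Proof.
elim: n a => [|n IH] a au; first by rewrite !big_ord0 derivC horner0 mulr0.
rewrite !big_ord_recr/= derivM derivXsubC mulr1 hornerD hornerM hornerXsubC.
rewrite IH// horner_prod; move: (z - a ord_max) (au ord_max) => b bu.
rewrite mulrDr mulrK// mulrAC.
by congr (_ + _); apply: eq_bigr => j _; rewrite hornerXsubC.
Qed.

(** * The Gauss-Lucas weights *)

Theorem theorem2p2 (R : realType) (A : comCStarAlgType R)
    (hdense : dense (invertibles A))
    (n : nat) (hn : (1 <= n)%N) (a : 'I_n -> A) :
  let P : {poly A} := \prod_(j < n) ('X - (a j)%:P) in
  let p : A -> A := fun z => P.[z] in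
  let B : set A := [set z | forall j : 'I_n, invertibles A (z - a j)] in
  let C : set A := [set z | is_cstar_derive p z 0] in
  forall z : A, (B `&` C) z ->
    exists w : 'I_n -> A,
      [/\ forall j : 'I_n, cstar_positive (w j),
          z = \sum_(j < n) w j * a j
        & \sum_(j < n) w j = 1].
Proof.
move=> P p B C z [zB zC].
have zu j : z - a j \is a GRing.unit by exact: zB.
pose u j := (z - a j)^-1.
have uu j : u j \is a GRing.unit by rewrite unitrV.
have u0 : \sum_(j < n) u j = 0.
  have := is_cstar_derive_horner hdense zC; rewrite deriv_prodXsubC//.
  have pu : \prod_(j < n) (z - a j) \is a GRing.unit.
    by apply: rpred_prod => j _.
  by rewrite -[RHS](mulr0 (\prod_(j < n) (z - a j))) => /(mulrI pu).
pose S := \sum_(j < n) star (u j) * u j.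
(* The bound 1 <= n supplies the index 0, whose term is invertible. *)
have Su : S \is a GRing.unit := starsq_sum_unit (uu (Ordinal hn)).
have starM_comm (x y : A) : star (x * y) = star x * star y.
  by rewrite starM mulrC.
have SS : star S = S.
  rewrite star_sum; apply: eq_bigr => j _.
  by rewrite starM_comm starK mulrC.
have [_ sSV] := starV Su; rewrite SS in sSV.
exists (fun j => star (u j) * u j / S); split; last by rewrite -mulr_suml divrr.
- move=> j; apply: norm_pos_cstar_positive.
    by rewrite !starM_comm starK sSV (mulrC (u j)).
  (* Multiply by S / S and expand the numerator S; since S is self-adjoint, the two factors [S^-1]
     are shared between an element and its star. *)
  have -> : star (u j) * u j / S =
      \sum_(k < n) star (u j * u k / S) * (u j * u k / S).
    rewrite -[in LHS](mulr1 (_ / S)) -(divrr Su) {2}/S mulr_suml mulr_sumr.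
    by apply: eq_bigr => k _; rewrite !starM_comm sSV; ring.
  by apply: norm_pos_sum => k; exact: norm_pos_starsq.
- apply: (mulrI Su); rewrite mulr_sumr.
  have -> : \sum_(j < n) S * (star (u j) * u j / S * a j) =
      \sum_(j < n) star (u j) * u j * a j.
    apply: eq_bigr => j _.
    have -> : S * (star (u j) * u j / S * a j) = S / S * (star (u j) * u j * a j).
      by ring.
    by rewrite divrr// mul1r.
  (* The difference of the two sides is a sum of terms [star (u j) * u j * (z - a j)], each equal to
     [star (u j)], so it is the star of the vanishing sum of the [u j]. *)
  apply/eqP; rewrite -subr_eq0 mulr_suml -sumrB; apply/eqP.
  rewrite (eq_bigr (fun j => star (u j))) => [|j _].
    by rewrite -star_sum u0 star0.
  by rewrite -mulrBr -mulrA mulVr// mulr1.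
Qed.
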